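(* Let $S$ be a bzi-semiring. An ideal $\mathfrak{q}$ of $S$ is $z$-semiprime if and only if $\mathfrak{q}$ is a $z$-ideal and a semiprime ideal of $S$.
   Context: A (commutative) semiring is a system $(S,+,0,\cdot,1)$ with $(S,+,0)$ and $(S,\cdot,1)$ commutative monoids, $0s=0$ for all $s\in S$, and multiplication distributing over addition. An ideal of $S$ is a nonempty subset closed under addition and under multiplication by elements of $S$; it is proper if it is not $S$. The product $\mathfrak{a}\mathfrak{b}$ of ideals is the ideal generated by $\{ab\mid a\in\mathfrak{a},b\in\mathfrak{b}\}$. A proper ideal $\mathfrak{q}$ is semiprime if $\mathfrak{a}^2\subseteq\mathfrak{q}$ implies $\mathfrak{a}\subseteq\mathfrak{q}$ for all ideals $\mathfrak{a}$ of $S$. $\mathrm{Max}(S)$ is the set of maximal (proper) ideals of $S$, and for $x\in S$, $\mathcal{M}_x=\{\mathfrak{m}\in\mathrm{Max}(S)\mid x\in\mathfrak{m}\}$. An ideal $\mathfrak{z}$ of $S$ is a $z$-ideal if $\bigcap\mathcal{M}_x\subseteq\mathfrak{z}$ for every $x\in\mathfrak{z}$ (the intersection of the empty family is $S$). A basic $z$-ideal is an ideal of the form $\mathsf{m}_x=\bigcap\mathcal{M}_x$, $x\in S$; $S$ is a bzi-semiring if $\mathsf{m}_x\mathsf{m}_x=\mathsf{m}_x$ for all $x\in S$. A proper $z$-ideal $\mathfrak{q}$ is $z$-semiprime if $\mathfrak{a}^2\subseteq\mathfrak{q}$ implies $\mathfrak{a}\subseteq\mathfrak{q}$ for all $z$-ideals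 $\mathfrak{a}$ of $S$. *)

(* Defs.v *)
From mathcomp Require Import all_boot all_algebra.
From mathcomp Require Import classical_sets.
Set Implicit Arguments.
Unset Strict Implicit.
Unset Printing Implicit Defensive.
Import GRing.Theory.
Local Open Scope classical_set_scope.
Local Open Scope ring_scope.

(* Commutative semirings with unit are [comPzSemiRingType]; [1 = 0] is allowed. *)
Section Ideals.
Context {S : comPzSemiRingType}.
Implicit Types (A B I M Q Z : set S) (x : S).

Definition ideal I : Prop :=
  [/\ I !=set0,
      forall a b, I a -> I b -> I (a + b)
    & forall s a, I a -> I (s * a)].

Definition proper_ideal I : Prop := ideal I /\ I <> setT.

Definition ideal_prod A B : set S :=
  smallest ideal [set a * b | a in A & b in B].

Definition semiprime_ideal Q : Prop :=
  proper_ideal Q /\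
  forall A, ideal A -> ideal_prod A A `<=` Q -> A `<=` Q.

Definition maximal_ideal M : Prop :=
  proper_ideal M /\
  forall I, proper_ideal I -> M `<=` I -> I = M.

Definition maximal_ideals_at x : set (set S) :=
  [set M | maximal_ideal M /\ M x].

(* When no maximal ideal contains [x], this intersection is [setT]. *)
Definition basic_z_ideal x : set S :=
  \bigcap_(M in maximal_ideals_at x) M.

Definition z_ideal Z : Prop :=
  ideal Z /\ forall x, Z x -> basic_z_ideal x `<=` Z.

Definition z_semiprime_ideal Q : Prop :=
  [/\ proper_ideal Q, z_ideal Q
    & forall A, z_ideal A -> ideal_prod A A `<=` Q -> A `<=` Q].

End Ideals.

Definition bzi_semiring (S : comPzSemiRingType) : Prop :=
  forall x : S,
    ideal_prod (basic_z_ideal x) (basic_z_ideal x) = basic_z_ideal x.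

(* Main.v *)
Require Import Defs.
From mathcomp Require Import all_boot all_algebra.
From mathcomp Require Import classical_sets.
From mathcomp Require boolp.

(** The point is that every [z]-ideal [q] is radical: maximal ideals are prime,
    so every maximal ideal containing [x ^ 2] contains [x], that is, [x] lies in
    [m_(x ^ 2)], which is included in [q] as soon as [x ^ 2] lies in [q]. *)

Import GRing.Theory.
Local Open Scope classical_set_scope.
Local Open Scope ring_scope.

Lemma ideal_add_principal (S : comPzSemiRingType) (I : set S) (x : S) :
  ideal I -> ideal [set m + s * x | m in I & s in setT].
Proof.
case=> -[m0 Im0] addI mulI; split.
- by exists (m0 + 0 * x); exists m0 => //; exists 0.
- move=> _ _ [m Im [s _ <-]] [n In [t _ <-]].
  exists (m + n); first exact: addI.
  by exists (s + t) => //; rewrite mulrDl addrACA.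
- move=> r _ [m Im [s _ <-]].
  exists (r * m); first exact: mulI.
  by exists (r * s) => //; rewrite mulrDr mulrA.
Qed.

(** The ideal [J], that is $M + Sx$, contains $M$, so by maximality it is $S$ or $M$. If it is $S$,
    then $1 = m + sx$ with $m \in M$, and multiplying by $x$ gives $x = mx + s x^2 \in M$. Otherwise
    $x = 0 + 1x$ lies in $J = M$. *)
Lemma maximal_ideal_sqr (S : comPzSemiRingType) (M : set S) (x : S) :
  maximal_ideal M -> M (x * x) -> M x.
Proof.
move=> [[idM _] maxM] Mxx; have [[m0 Mm0] addM mulM] := idM.
have M0 : M 0 by rewrite -(mul0r m0); exact: mulM.
pose J := [set m + s * x | m in M & s in setT].
have [JT|properJ] := boolp.pselect (J = setT).
  have [m Mm [s _ msx1]] : J 1 by rewrite JT.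
  rewrite -(mul1r x) -msx1 mulrDl -mulrA.
  by apply: addM; [rewrite mulrC|]; exact: mulM.
have <- : J = M.
  apply: maxM; first by split=> //; exact: ideal_add_principal.
  by move=> m Mm; exists m => //; exists 0 => //; rewrite mul0r addr0.
by exists 0 => //; exists 1 => //; rewrite mul1r add0r.
Qed.

Lemma z_ideal_sqr (S : comPzSemiRingType) (Z : set S) (x : S) :
  z_ideal Z -> Z (x * x) -> Z x.
Proof.
move=> [_ zZ] Zxx; apply: (zZ _ Zxx) => M [maxM Mxx].
exact: maximal_ideal_sqr Mxx.
Qed.

Theorem proposition4p9 (S : comPzSemiRingType) (hS : bzi_semiring S)
    (q : set S) (hq : ideal q) :
  z_semiprime_ideal q <-> z_ideal q /\ semiprime_ideal q.
Proof.
split=> [[properq zq _]|[zq [properq semiq]]].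
  split=> //; split=> // A _ AAq x Ax.
  (* For $x \in A$, the square $x^2$ is one of the generators of $A A$, hence lies in [q], and [q]
     is radical. *)
  apply: z_ideal_sqr zq _; apply: AAq => I [_ genI].
  by apply: genI; exists x => //; exists x.
(* Semiprimeness tests all ideals, in particular the $z$-ideals. *)
by split=> // A [idA _]; exact: semiq.
Qed.
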